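(* For every integer $\Delta\ge2$ and every positive integer $n$ we have $f(n,\Delta)\ge\left\lfloor\frac{n-2}{\Delta}\right\rfloor$. Moreover, for every positive integer $n$ we have $f(n,2)=\lceil n/2\rceil-1$, and there exists $n_0$ such that if $n>n_0$ then \[ 0.3411\,n< f(n,3)\le f^*(n,3)<0.4591\,n. \]
   Context: An $n\times n$ bipartite graph is a bipartite graph $G=(A\cup B,E)$ with a fixed bipartition into parts $A,B$ with $|A|=|B|=n$. A bi-hole of size $k$ in such a graph is a pair $(X,Y)$ with $X\subseteq A$, $Y\subseteq B$, $|X|=|Y|=k$, such that no edge of $G$ joins a vertex of $X$ to a vertex of $Y$. $f(n,\Delta)$ is the largest integer $k$ such that every $n\times n$ bipartite graph $G=(A\cup B,E)$ with $\deg(a)\le\Delta$ for all $a\in A$ contains a bi-hole of size $k$. $f^*(n,\Delta)$ is the largest integer $k$ such that every $n\times n$ bipartite graph with maximum degree at most $\Delta$ contains a bi-hole of size $k$. *)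

(* Defs.v *)
From mathcomp Require Import all_boot all_order all_algebra.

Set Implicit Arguments.
Unset Strict Implicit.
Unset Printing Implicit Defensive.

(* An n x n bipartite graph with both parts labelled by 'I_n: the pair (a, b)
   is in the set iff the vertex a of A is adjacent to the vertex b of B. *)
Definition bigraph (n : nat) := {set 'I_n * 'I_n}.

Section Bigraph.

Variable n : nat.
Implicit Types (G : bigraph n) (X Y : {set 'I_n}) (D k : nat).

Definition degA G (a : 'I_n) : nat := #|[set b | (a, b) \in G]|.
Definition degB G (b : 'I_n) : nat := #|[set a | (a, b) \in G]|.

Definition maxdegA_le D G : bool := [forall a, degA G a <= D].
Definition maxdeg_le D G : bool :=
  [forall a, degA G a <= D] && [forall b, degB G b <= D].

Definition bihole G k X Y : bool :=
  [&& #|X| == k, #|Y| == k & [forall x in X, forall y in Y, (x, y) \notin G]].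

Definition has_bihole G k : bool := [exists X, exists Y, bihole G k X Y].

Definition forces_bihole (P : pred (bigraph n)) k : bool :=
  [forall G : bigraph n, P G ==> has_bihole G k].

Lemma forces_bihole0 (P : pred (bigraph n)) : exists k, forces_bihole P k.
Proof.
exists 0; apply/forallP=> G; apply/implyP=> _.
apply/existsP; exists set0; apply/existsP; exists set0.
rewrite /bihole cards0 eqxx /=.
by apply/forall_inP=> x; rewrite inE.
Qed.

Lemma forces_bihole_le (P : pred (bigraph n)) G : P G -> forall k, forces_bihole P k -> k <= n.
Proof.
move=> PG k /forallP/(_ G); rewrite PG /= => /existsP[X /existsP[Y]].
by case/and3P=> /eqP <- _ _; rewrite -[leqRHS]card_ord max_card.
Qed.

Lemma maxdegA_le_set0 D : maxdegA_le D set0.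
Proof.
apply/forallP=> a; rewrite /degA (_ : [set _ | _] = set0) ?cards0 //.
by apply/setP=> b; rewrite !inE.
Qed.

Lemma maxdeg_le_set0 D : maxdeg_le D set0.
Proof.
rewrite /maxdeg_le [X in X && _]maxdegA_le_set0; apply/forallP=> b.
rewrite /degB (_ : [set _ | _] = set0) ?cards0 //.
by apply/setP=> a; rewrite !inE.
Qed.

End Bigraph.

(* ex_maxn gives the largest k satisfying the predicate; its arguments are
   proofs that some k satisfies it and that n bounds all such k. *)
Definition f (n D : nat) : nat :=
  ex_maxn (forces_bihole0 (@maxdegA_le n D))
          (forces_bihole_le (maxdegA_le_set0 n D)).

Definition fstar (n D : nat) : nat :=
  ex_maxn (forces_bihole0 (@maxdeg_le n D))
          (forces_bihole_le (maxdeg_le_set0 n D)).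

(* Main.v *)
Require Import Defs.
From mathcomp Require Import all_boot all_order all_algebra.
From mathcomp Require Import all_fingroup.
From mathcomp Require Import zify.
From Stdlib Require BinNat Nnat.

Set Implicit Arguments.
Unset Strict Implicit.
Unset Printing Implicit Defensive.

(** Lower bounds: build the B-side Y of a hole greedily, X being the set of
    vertices of A not adjacent to Y.  The degrees into X sum to at most D |X|
    over the n - j vertices of B not yet chosen, so some vertex costs at most
    floor (D |X| / (n - j)).  If |X| = n - 1 at the start, this is at most
    D - 1 throughout, hence f(n, D) >= (n - 1) / D, which is sharp for D = 2 by
    the 2n-cycle.  For D = 3 the cost drops to 1 after about n / 4 steps, when
    |X| < (2/3)(n - j); stopping at j = |X| gives about 3n/8 > 0.3411 n.

    Upper bound for f*(n, 3): in the union of three random perfect matchings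
    the expected number of bi-holes of size k is
    'C(n, k)^2 ('C(n - k, k) / 'C(n, k))^3, which is below 1 as soon as
    'C(n - k, k)^3 < 'C(n, k).  We take k / n close to 101 / 220 < 0.4591. *)

(** * Bi-holes with slack on one side *)

Lemma exists_subset_card (T : finType) (X : {set T}) k : k <= #|X| ->
  exists2 X' : {set T}, X' \subset X & #|X'| = k.
Proof.
rewrite -bin_gt0 -cards_draws => /card_gt0P[A].
by rewrite inE => /andP[sA /eqP cA]; exists A.
Qed.

(** Only a lower bound on |X| is kept, as the greedy steps control no more; trimming X recovers a
    bi-hole. *)
Definition has_hole n (G : bigraph n) e j : Prop :=
  exists X Y : {set 'I_n}, [/\ e <= #|X|, #|Y| = j &
    {in X & Y, forall x y, (x, y) \notin G}].

Lemma has_holeW n (G : bigraph n) e e' j :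
  e' <= e -> has_hole G e j -> has_hole G e' j.
Proof.
by move=> le_e [X [Y [leX cY XY]]]; exists X, Y; split=> //; apply: leq_trans leX.
Qed.

Lemma has_hole_bihole n (G : bigraph n) k : has_hole G k k -> has_bihole G k.
Proof.
case=> X [Y [leX cY XY]].
have [X' sX' cX'] := exists_subset_card leX.
apply/existsP; exists X'; apply/existsP; exists Y.
rewrite /bihole cX' cY !eqxx /=.
apply/forall_inP=> x X'x; apply/forall_inP=> y Yy.
by apply: XY => //; apply: (subsetP sX').
Qed.

(** * Greedy lower bounds *)

(** Double counting: each vertex of X sends at most D edges into Y. *)
Lemma sum_deg_le n (G : bigraph n) D (X Y : {set 'I_n}) : maxdegA_le D G ->
  \sum_(b in Y) #|[set a in X | (a, b) \in G]| <= D * #|X|.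
Proof.
move=> /forallP degG; rewrite mulnC -sum_nat_const.
under eq_bigr => b _ do rewrite -sum1dep_card big_mkcondr /=.
rewrite exchange_big /=; apply: leq_sum => a _.
apply: leq_trans (degG a); rewrite /degA -sum1dep_card -big_mkcondr.
rewrite [leqLHS]big_mkcond [leqRHS]big_mkcond; apply: leq_sum => b _ /=.
by case: (b \in Y).
Qed.

(* Moving to Y a vertex of least degree into X, which averaging bounds by c. *)
Lemma has_hole_step n (G : bigraph n) D e j c : maxdegA_le D G ->
  D * e < c.+1 * (n - j) -> has_hole G e j -> has_hole G (e - c) j.+1.
Proof.
move=> degG lt_c [X0 [Y [leX cY XY]]].
have [X sX cX] := exists_subset_card leX.
pose N b := [set a in X | (a, b) \in G].
have [b Yb leNb] : exists2 b, b \notin Y & #|N b| <= c.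
  apply/exists_inP; apply: contraLR lt_c => /exists_inPn noB.
  rewrite -leqNgt -cX; apply: leq_trans (sum_deg_le X (~: Y) degG).
  have cYC : #|~: Y| = n - j by rewrite cardsCs setCK card_ord cY.
  rewrite mulnC -cYC -sum_nat_const; apply: leq_sum => b; rewrite inE => Yb.
  by rewrite ltnNge; apply: noB.
exists (X :\: N b), (b |: Y); split.
- rewrite cardsD; have : #|X :&: N b| <= c.
    exact: leq_trans (subset_leq_card (subsetIr _ _)) leNb.
  lia.
- by rewrite cardsU1 Yb cY.
move=> x y; rewrite !inE => /andP[Nx Xx] /predU1P[->|Yy].
  by move: Nx; rewrite Xx.
by apply: XY => //; apply: (subsetP sX).
Qed.

(** Starting from n - 1 rather than n makes the averaging strict: D (n - 1 - j (D - 1)) < D (n -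
    j). *)
Lemma has_hole_linear n (G : bigraph n) D j : 2 <= D -> maxdegA_le D G ->
  j <= n -> has_hole G (n.-1 - j * D.-1) j.
Proof.
move=> D2 degG; elim: j => [|j IHj] ltjn.
  exists setT, set0; split; rewrite ?cards0 //; first by rewrite cardsT card_ord; lia.
  by move=> x y _; rewrite inE.
rewrite mulSn addnC subnDA; apply: has_hole_step degG _ (IHj (ltnW ltjn)).
have D0 : 0 < D by lia.
rewrite prednK // ltn_pmul2l //.
have : j <= j * D.-1 by apply: leq_pmulr; lia.
lia.
Qed.

Lemma f_ge n D k :
  (forall G : bigraph n, maxdegA_le D G -> has_hole G k k) -> k <= f n D.
Proof.
move=> holeG; rewrite /f; case: ex_maxnP => i _; apply.
by apply/forallP=> G; apply/implyP=> /holeG/has_hole_bihole.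
Qed.

Lemma f_ge_linear n D : 2 <= D -> 0 < n -> n.-1 %/ D <= f n D.
Proof.
move=> D2 n0; apply: f_ge => G degG.
have le_kD : n.-1 %/ D * D <= n.-1 by apply: leq_divM.
have le_k : n.-1 %/ D <= n.-1 by apply: leq_div.
apply: has_holeW (has_hole_linear D2 degG _); last lia.
by rewrite -{2}(prednK (ltnW D2)) mulnS in le_kD; lia.
Qed.

(* After the first quarter of the steps the average degree into X is below 2,
   so that each later step costs a single vertex of X. *)
Lemma f3_ge n : 12 < n -> n.-1 %/ 4 + 1 + (n.-1 - 3 * (n.-1 %/ 4 + 1))./2 <= f n 3.
Proof.
move=> n0; set q := _ + 1; set i := half _; apply: f_ge => G degG.
have n_big : 3 * q <= n.-1 by rewrite /q; lia.
have qn : n.-1 < 4 * q by rewrite /q; lia.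
have iq : i.*2 <= n.-1 - 3 * q by rewrite /i; lia.
have step t : t <= i -> has_hole G (n.-1 - q * 2 - t) (q + t).
  elim: t => [|t IHt] le_t.
    by rewrite subn0 addn0; apply: (@has_hole_linear n G 3) => //; lia.
  (* Cost 1 suffices: 3 (n - 1 - 2q - t) < 2 (n - q - t) since n - 1 < 4q. *)
  rewrite addnS subnS -subn1; apply: has_hole_step degG _ (IHt (ltnW le_t)); lia.
by apply: has_holeW (step i (leqnn _)); lia.
Qed.

(** * The 2n-cycle and the value of f(n, 2) *)

Definition cycle_graph n : bigraph n := [set p | (p.2 == p.1) || (p.2 == ordS p.1)].

Lemma cycle_graph_degA n : maxdegA_le 2 (cycle_graph n).
Proof.
apply/forallP=> a; rewrite /degA (_ : [set _ | _] = [set a; ordS a]).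
  by rewrite cards2; case: (_ != _).
by apply/setP=> b; rewrite !inE.
Qed.

(** [ordS] permutes ['I_n] in a single cycle. *)
Lemma ordS_closed n (X : {set 'I_n}) x :
  {in X, forall y, ordS y \in X} -> x \in X -> X = setT.
Proof.
move=> clX Xx; apply/setP=> y; rewrite inE.
have iterX t : iter t (@ordS n) x \in X by elim: t => //= t; apply: clX.
have iterE t : val (iter t (@ordS n) x) = (x + t) %% n.
  elim: t => [|t IHt] /=; first by rewrite addn0 modn_small.
  by rewrite IHt addnS -[in LHS]addn1 modnDml addn1.
(* The added n keeps the subtraction from truncating when y < x. *)
have -> : y = iter (y + n - x) (@ordS n) x.
  apply: val_inj; rewrite iterE subnKC ?modnDr ?modn_small //.
  exact/ltnW/ltn_addl.
exact: iterX.
Qed.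

(** Y avoids X and its shift by [ordS]. If 2k >= n, then X is the complement of Y, hence closed
    under [ordS], hence everything, leaving no room for Y. *)
Lemma f2_le n : 0 < n -> f n 2 <= n.-1./2.
Proof.
move=> n0; rewrite /f; case: ex_maxnP => k /forallP/(_ (cycle_graph n)).
rewrite cycle_graph_degA /= => /existsP[X /existsP[Y]].
case/and3P=> /eqP cX /eqP cY /forall_inP XY _.
rewrite leqNgt; apply/negP=> ltk.
have k0 : 0 < k by lia.
have sXY z : (z \in X) || [exists x in X, z == ordS x] -> z \notin Y.
  case/orP=> [Xz|/exists_inP[x Xx /eqP->]]; apply/negP=> Yz.
    by have /forall_inP/(_ _ Yz) := XY _ Xz; rewrite inE /= eqxx.
  by have /forall_inP/(_ _ Yz) := XY _ Xx; rewrite inE /= eqxx orbT.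
have eqX : X = ~: Y.
  apply/eqP; rewrite eqEcard cardsCs setCK card_ord cX cY; apply/andP; split; last lia.
  by apply/subsetP=> z Xz; rewrite inE sXY ?Xz.
have [x Xx] : exists x, x \in X by apply/card_gt0P; rewrite cX.
have XT : X = setT.
  apply: ordS_closed Xx => y Xy; rewrite eqX inE sXY //.
  by apply/orP; right; apply/exists_inP; exists y.
have := sXY; have [y Yy] : exists y, y \in Y by apply/card_gt0P; rewrite cY.
by move/(_ y); rewrite XT inE Yy => /(_ isT).
Qed.

(** * Random matchings and the upper bound for [fstar] *)

Lemma f_le_fstar n D : f n D <= fstar n D.
Proof.
rewrite /f /fstar; case: ex_maxnP => i /forallP Pi _; case: ex_maxnP => j _; apply.
by apply/forallP=> G; apply/implyP=> /andP[degG _]; apply: (implyP (Pi G)).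
Qed.

(** List each set followed by its complement and match the two lists by position. *)
Lemma exists_perm_imset (T : finType) (X X' : {set T}) : #|X| = #|X'| ->
  exists t : {perm T}, t @: X = X'.
Proof.
move=> eqc; pose e (A : {set T}) := enum A ++ enum (~: A).
have size_e A : size (e A) = #|T| by rewrite size_cat -!cardE cardsC.
have uniq_e A : uniq (e A).
  rewrite cat_uniq !enum_uniq andbT /=; apply/hasPn=> x.
  by rewrite !mem_enum inE.
have mem_e A x : x \in e A by rewrite mem_cat !mem_enum inE orbN.
pose g x := nth x (e X') (index x (e X)).
have ltix x : index x (e X) < #|T| by rewrite -(size_e X) index_mem.
have inj_g : injective g.
  move=> x y; rewrite /g (set_nth_default y) ?size_e // => /eqP.
  rewrite nth_uniq ?size_e // => /eqP eqi.
  by rewrite -(nth_index y (mem_e X x)) eqi nth_index.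
exists (perm inj_g); apply/eqP; rewrite eqEcard card_imset ?eqc; last exact: perm_inj.
rewrite leqnn andbT; apply/subsetP=> _ /imsetP[x Xx ->]; rewrite permE /g.
have ltX : index x (enum X) < #|X'| by rewrite -eqc cardE index_mem mem_enum.
rewrite /e index_cat mem_enum Xx nth_cat -cardE ltX -mem_enum mem_nth //.
by rewrite -cardE.
Qed.

Lemma card_perm_type (T : finType) : #|{perm T}| = #|T|`!.
Proof.
have := card_perm [set: T]; rewrite cardsT => <-.
by apply: eq_card => s; rewrite !inE; apply/esym/subsetP=> x; rewrite inE.
Qed.

(** Count pairs (s, A) with |A| = |X| and s(A) inside Z: by symmetry every A has equally many s, and
    for each s the sets A are the |X|-subsets of the preimage of Z. *)
Lemma card_perm_imset_sub (T : finType) (X Z : {set T}) :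
  #|[set s : {perm T} | s @: X \subset Z]| * 'C(#|T|, #|X|)
  = #|T|`! * 'C(#|Z|, #|X|).
Proof.
pose N (A : {set T}) := #|[set s : {perm T} | s @: A \subset Z]|.
have Nconst (A : {set T}) : #|A| == #|X| -> N A = N X.
  move/eqP/esym=> /exists_perm_imset[t tX]; rewrite /N -!sum1dep_card.
  rewrite [RHS](reindex_inj (mulgI t)); apply: eq_bigl => s.
  suff -> : (t * s)%g @: X = s @: A by [].
  by rewrite -tX -imset_comp; apply: eq_imset => x /=; rewrite permM.
rewrite -/(N X) mulnC -card_draws -sum_nat_const.
rewrite (eq_bigr N) => [|A]; last by rewrite inE => /Nconst.
under eq_bigr => A _ do rewrite /N -sum1dep_card.
rewrite -[in RHS]card_perm_type -sum_nat_const (exchange_big_dep predT) //=.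
apply: eq_bigr => s _.
rewrite -(card_preimset Z (@perm_inj T s)) -cards_draws -sum1dep_card.
by apply: eq_bigl => A; rewrite inE sub_imset_pre andbC.
Qed.

Definition perm_graph n D (s : {ffun 'I_D -> {perm 'I_n}}) : bigraph n :=
  [set p | [exists i, p.2 == s i p.1]].

Lemma perm_graph_maxdeg n D (s : {ffun 'I_D -> {perm 'I_n}}) :
  maxdeg_le D (perm_graph s).
Proof.
have leD (h : 'I_D -> 'I_n) : #|[set h i | i in 'I_D]| <= D.
  by apply: leq_trans (leq_imset_card _ _) _; rewrite card_ord.
apply/andP; split; apply/forallP=> a.
  apply: leq_trans (leD (fun i => s i a)); apply: subset_leq_card.
  apply/subsetP=> b; rewrite !inE => /existsP[i /eqP/= ->].
  exact: imset_f.
apply: leq_trans (leD (fun i => (s i)^-1%g a)); apply: subset_leq_card.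
apply/subsetP=> b; rewrite !inE => /existsP[i /eqP/= ->].
by apply/imsetP; exists i; rewrite ?permK.
Qed.

(* First moment: if every D-tuple of permutations left a hole of size k, then
   counting pairs (tuple, hole) would give n!^D <= 'C(n, k)^2 (n! p)^D with
   p = 'C(n - k, k) / 'C(n, k). *)
Lemma fstar_lt n D k : 1 < D -> 'C(n - k, k) ^ D < 'C(n, k) ^ (D - 2) -> fstar n D < k.
Proof.
move=> D2; apply: contraLR; rewrite -!leqNgt => le_k.
have holes (s : {ffun 'I_D -> {perm 'I_n}}) :
    exists p : {set 'I_n} * {set 'I_n}, [/\ #|p.1| = k, #|p.2| = k &
      forall i, s i @: p.1 \subset ~: p.2].
  move: le_k; rewrite /fstar; case: ex_maxnP => j /forallP/(_ (perm_graph s)).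
  rewrite perm_graph_maxdeg /= => /existsP[X /existsP[Y]].
  case/and3P=> /eqP cX /eqP cY /forall_inP XY _ le_kj.
  have [X' sX cX'] : exists2 X' : {set 'I_n}, X' \subset X & #|X'| = k.
    by apply: exists_subset_card; rewrite cX.
  have [Y' sY cY'] : exists2 Y' : {set 'I_n}, Y' \subset Y & #|Y'| = k.
    by apply: exists_subset_card; rewrite cY.
  exists (X', Y'); split=> // i; apply/subsetP=> _ /imsetP[x X'x ->].
  rewrite inE; apply/negP=> /(subsetP sY) Yy.
  have /forall_inP/(_ _ Yy) := XY x (subsetP sX x X'x).
  by rewrite inE /= => /existsP[]; exists i.
have le_kn : k <= n.
  by have [[X Y] [<- _ _]] := holes [ffun=> 1%g]; rewrite -[leqRHS]card_ord max_card.
pose P := setX [set X : {set 'I_n} | #|X| == k] [set Y : {set 'I_n} | #|Y| == k].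
have cardP : #|P| = 'C(n, k) ^ 2 by rewrite cardsX !card_draws card_ord mulnn.
pose N (p : {set 'I_n} * {set 'I_n}) :=
  [set t : {perm 'I_n} | t @: p.1 \subset ~: p.2].
have cardN p : p \in P -> #|N p| * 'C(n, k) = n`! * 'C(n - k, k).
  case: p => X Y; rewrite !inE => /andP[/eqP/= cX /eqP/= cY].
  have := card_perm_imset_sub X (~: Y).
  by rewrite card_ord cX [#|~: Y|]cardsCs setCK card_ord cY.
(* Union bound: every tuple has a hole p, and the tuples with hole p are the functions into
   [N p]. *)
have le_fact : n`! ^ D <= \sum_(p in P) #|N p| ^ D.
  have cardS : #|{ffun 'I_D -> {perm 'I_n}}| = n`! ^ D.
    by rewrite card_ffun card_perm_type !card_ord.
  have cardH p : #|N p| ^ D = \sum_(s : {ffun 'I_D -> {perm 'I_n}} | s \in ffun_on (mem (N p))) 1.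
    by rewrite sum1_card card_ffun_on card_ord.
  under eq_bigr => p _ do rewrite cardH.
  rewrite -cardS -sum1_card (exchange_big_dep predT) //=.
  apply: leq_sum => s _; rewrite sum1dep_card; apply/card_gt0P.
  have [p [cX cY sp]] := holes s; exists p; rewrite !inE cX cY !eqxx /=.
  by apply/ffun_onP=> i; rewrite inE.
have C0 : 0 < 'C(n, k) by rewrite bin_gt0.
have : n`! ^ D * 'C(n, k) ^ D <= 'C(n, k) ^ 2 * (n`! * 'C(n - k, k)) ^ D.
  apply: leq_trans (leq_mul le_fact (leqnn _)) _.
  rewrite big_distrl -cardP -sum_nat_const /=; apply: leq_sum => p Pp.
  by rewrite -expnMn cardN.
rewrite expnMn mulnCA leq_pmul2l ?expn_gt0 ?fact_gt0 //.
by rewrite -{1}(subnKC D2) expnD leq_pmul2l ?expn_gt0 ?C0.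
Qed.

(** * Estimates of binomial coefficients *)

Lemma bin_expn_le a b N i : 'C(N, i) * (a ^ (N - i) * b ^ i) <= (a + b) ^ N.
Proof.
have [ltNi|leiN] := ltnP N i; first by rewrite bin_small.
rewrite expnDn -ltnS in leiN *.
by rewrite (bigD1 (Ordinal leiN)) //= leq_addr.
Qed.

(* The largest term in the binomial expansion of (a + b)^N sits at i = m b. *)
Lemma expn_le_bin a b m : 0 < a -> 0 < b ->
  (a + b) ^ ((a + b) * m) <=
  ((a + b) * m).+1 * ('C((a + b) * m, b * m) * (a ^ (a * m) * b ^ (b * m))).
Proof.
move=> a0 b0; set N := (a + b) * m.
pose t i := 'C(N, i) * (a ^ (N - i) * b ^ i).
(* The ratio of consecutive terms is (N - i) b / ((i + 1) a): at least 1 for i < b m, at most 1 from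
   b m on. *)
have tS i : i < N -> (i.+1 * a) * t i.+1 = ((N - i) * b) * t i.
  move=> ltiN; transitivity (i.+1 * 'C(N, i.+1) * (a ^ (N - i) * b ^ i.+1)).
    rewrite /t -(subnSK ltiN) (expnS a).
    by move: 'C(N, i.+1) (a ^ _) (b ^ _) => x y z; lia.
  rewrite mul_bin_left /t expnS.
  by move: 'C(N, i) (N - i) (a ^ (N - i)) (b ^ i) => x y z w; lia.
have t_up d : d <= b * m -> t (b * m - d) <= t (b * m).
  elim: d => [|d IHd] le_d; first by rewrite subn0.
  apply: leq_trans (IHd (ltnW le_d)); rewrite -(subnSK le_d).
  set i := b * m - d.+1; have ltiN : i < N by rewrite /i /N; nia.
  rewrite -(@leq_pmul2l (i.+1 * a)) ?muln_gt0 // tS // leq_mul2r.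
  by apply/orP; right; rewrite /i /N; nia.
have t_down d : b * m + d <= N -> t (b * m + d) <= t (b * m).
  elim: d => [|d IHd]; first by rewrite addn0.
  rewrite addnS => ltiN; apply: leq_trans (IHd (ltnW ltiN)).
  rewrite -(@leq_pmul2l ((N - (b * m + d)) * b)) ?muln_gt0 ?subn_gt0 ?ltiN //.
  by rewrite -tS // leq_mul2r; apply/orP; right; rewrite /N; nia.
have t_max i : i <= N -> t i <= t (b * m).
  move=> leiN; have [le_i|/ltnW le_i] := leqP i (b * m).
    by rewrite -(subKn le_i) t_up // leq_subr.
  by rewrite -(subnKC le_i) t_down // subnKC.
have -> : a * m = N - b * m by rewrite /N mulnDl addnK.
rewrite expnDn -[X in X * _](card_ord N.+1) -sum_nat_const.
by apply: leq_sum => i _; apply: t_max; rewrite -ltnS.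
Qed.

(** The term 'C(m, 2) c^(m - 2) of (c + 1)^m already wins, being quadratic in m. *)
Lemma linear_lt_expn K c : 0 < c ->
  exists m0, forall m, m0 <= m -> K * m.+1 * c ^ m < c.+1 ^ m.
Proof.
move=> c0; exists (4 * (K * c ^ 2) + 5) => m le_m.
have := bin_expn_le c 1 m 2; rewrite addn1 exp1n muln1; apply: leq_trans.
have m2 : 2 <= m by lia.
have -> : c ^ m = c ^ (m - 2) * c ^ 2 by rewrite -expnD subnK.
rewrite mulnCA [ltnRHS]mulnC ltn_pmul2l ?expn_gt0 ?c0 //.
rewrite bin2; set L := K * c ^ 2 in le_m *.
have -> : K * m.+1 * c ^ 2 = L * m.+1 by rewrite /L; lia.
have : 2 * (L * m.+1) + 2 <= m * m.-1 by nia.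
lia.
Qed.

(** The ratio of the two coefficients is (N + 1) / (N + 1 - k). *)
Lemma bin_leS N k : 3 * k <= 2 * N.+1 -> 'C(N.+1, k) <= 3 * 'C(N, k).
Proof.
move=> le_k; rewrite -(@leq_pmul2l N.+1) // mulnCA mul_bin_down mulnA leq_mul2r.
by apply/orP; right; lia.
Qed.

Lemma bin_leD N k d : 3 * k <= 2 * N.+1 -> 'C(N + d, k) <= 3 ^ d * 'C(N, k).
Proof.
move=> le_k; elim: d => [|d IHd]; first by rewrite addn0 mul1n.
rewrite addnS expnS -mulnA; apply: leq_trans (bin_leS _) _; first lia.
by rewrite leq_pmul2l.
Qed.

(** Here A <= (U/V)^m and B >= (W/Q)^m / L, so B/A is at least ((c + 1)/c)^m / L, which exceeds
    T. *)
Lemma expn_gap_lt U V W Q A B T L c m : 0 < U -> 0 < Q ->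
  A * V ^ m <= U ^ m -> W ^ m <= L * (B * Q ^ m) ->
  U * Q * c.+1 <= W * V * c -> L * T * c ^ m < c.+1 ^ m -> T * A < B.
Proof.
move=> U0 Q0 leU leW leUW; apply: contraLR; rewrite -!leqNgt => leB.
have leWm : (W * V) ^ m <= L * T * (U * Q) ^ m.
  rewrite !expnMn; apply: leq_trans (leq_mul leW (leqnn _)) _.
  apply: leq_trans (_ : L * (T * A * Q ^ m) * V ^ m <= _); first by rewrite !leq_mul.
  rewrite (_ : L * _ * _ = L * T * Q ^ m * (A * V ^ m)); last by lia.
  by rewrite [U ^ m * _]mulnC [leqRHS]mulnA leq_mul2l leU orbT.
rewrite -(@leq_pmul2l ((U * Q) ^ m)) ?expn_gt0 ?muln_gt0 ?U0 ?Q0 // -expnMn.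
apply: leq_trans (_ : (W * V * c) ^ m <= _).
  by case: m {leU leW leB leWm} => // m; rewrite leq_exp2r.
by rewrite expnMn [leqRHS]mulnCA [leqRHS]mulnA leq_mul2r leWm orbT.
Qed.

(* Powers of this size cannot be evaluated in unary nat. *)
Section BinaryNumbers.

Import BinNat Nnat.

Lemma binary_expn_le (a b c d e g h i j k l o p q : N) :
  N.leb (a ^ b * (c ^ d * e ^ g) * h)%num (i ^ j * (k ^ l * o ^ p) * q)%num ->
  N.to_nat a ^ N.to_nat b * (N.to_nat c ^ N.to_nat d * N.to_nat e ^ N.to_nat g) * N.to_nat h
  <= N.to_nat i ^ N.to_nat j * (N.to_nat k ^ N.to_nat l * N.to_nat o ^ N.to_nat p) * N.to_nat q.
Proof.
have expE x y : N.to_nat x ^ N.to_nat y = N.to_nat (x ^ y)%num.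
  rewrite N2Nat.inj_pow; elim: (N.to_nat y) => //= n IH.
  by rewrite expnS IH multE.
have mulE x y : N.to_nat x * N.to_nat y = N.to_nat (x * y)%num.
  by rewrite N2Nat.inj_mul multE.
by rewrite !expE !mulE => /N.leb_le le_N; apply/leP; lia.
Qed.

(** With 119 = 220 - 101 and 18 = 119 - 101: per unit of m, the growth rates of 'C(119 m, 101 m)^3
    and 'C(220 m, 101 m) have ratio at most 16/17. *)
Lemma entropy_gap :
  119 ^ 357 * (101 ^ 101 * 119 ^ 119) * 17 <= 220 ^ 220 * (101 ^ 303 * 18 ^ 54) * 16.
Proof.
apply: (@binary_expn_le 119 357 101 101 119 119 17 220 220 101 303 18 54 16).
by vm_compute.
Qed.

End BinaryNumbers.

(** * The first-moment condition at density 101/220 *)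

Lemma bin_expn_block a b m e :
  'C((a + b) * m, b * m) ^ e * (b ^ (b * e) * a ^ (a * e)) ^ m
  <= ((a + b) ^ ((a + b) * e)) ^ m.
Proof.
have := bin_expn_le a b ((a + b) * m) (b * m).
case: e => [|e]; first by rewrite !muln0 !expn0 !exp1n.
have -> : (a + b) * m - b * m = a * m by rewrite mulnDl addnK.
rewrite -(@leq_exp2r _ _ e.+1) // !expnMn -!expnM.
by rewrite ![_ * m * _]mulnAC [X in _ * X <= _ -> _]mulnC.
Qed.

Lemma expn_le_bin_block a b m : 0 < a -> 0 < b ->
  ((a + b) ^ (a + b)) ^ m <=
  ((a + b) * m).+1 * ('C((a + b) * m, b * m) * (b ^ b * a ^ a) ^ m).
Proof. by move=> a0 b0; rewrite expnMn -!expnM [b ^ _ * _]mulnC expn_le_bin. Qed.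

(** Both sides are compared with their values at 220 m; as 220 m - n <= 220, this costs at most a
    factor 3^220. *)
Lemma bin_cube_lt : exists m0, forall m n, m0 <= m ->
  220 * m <= n + 220 -> n <= 220 * m ->
  'C(n - 101 * m, 101 * m) ^ 3 < 'C(n, 101 * m).
Proof.
have [m0 lt_m0] := @linear_lt_expn (220 * 3 ^ 220) 16 isT.
(* From m >= 4 on, 3 * 101 m <= 2 (n + 1), as [bin_leD] requires. *)
exists (m0 + 4) => m n le_m le_mn le_nm.
have lt_m := lt_m0 m (leq_trans (leq_addr _ _) le_m).
set A := 'C(119 * m, 101 * m); set B := 'C(220 * m, 101 * m).
have leA : 'C(n - 101 * m, 101 * m) ^ 3 <= A ^ 3.
  by rewrite leq_exp2r // leq_bin2l //; lia.
apply: leq_ltn_trans leA _.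
(* Stated with variables, so that [done] does not evaluate the powers. *)
have pos x y : 0 < x.+1 ^ y by rewrite expn_gt0.
have leB : B <= 3 ^ 220 * 'C(n, 101 * m).
  apply: leq_trans (leq_bin2l _ le_mn) (bin_leD _ _); lia.
rewrite -(@ltn_pmul2l (3 ^ 220)) ?expn_gt0 //; apply: leq_trans leB.
apply: (@expn_gap_lt (119 ^ 357) (101 ^ 303 * 18 ^ 54) (220 ^ 220)
  (101 ^ 101 * 119 ^ 119) _ _ (3 ^ 220) ((220 * m).+1) 16 m).
- exact: (pos 118).
- exact: (leq_mul (pos 100 101) (pos 118 119)).
- exact: (bin_expn_block 18 101 m 3).
- exact: (@expn_le_bin_block 119 101 m isT isT).
- exact: entropy_gap.
apply: leq_ltn_trans lt_m; rewrite leq_mul2r; apply/orP; right.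
by move: (3 ^ 220) => T; lia.
Qed.

Lemma fstar3_lt : exists n0, forall n, n0 < n -> fstar n 3 < 101 * (n %/ 220).+1.
Proof.
have [m0 lt_m0] := bin_cube_lt; exists (220 * m0) => n lt_n.
by apply: fstar_lt => //; rewrite expn1; apply: lt_m0; lia.
Qed.

(** * Decimal constants and the final bounds *)

Import Order.TTheory GRing.Theory Num.Theory.
Local Open Scope ring_scope.

(** Clearing the denominator of a reduced fraction leaves an inequality between naturals. *)
Lemma ltr_rat_mull (q : rat) (a b x y : nat) :
  numq q = a -> denq q = b -> (a * y < b * x)%N -> q * y%:Q < x%:Q.
Proof.
move=> qa qb lt_xy; have := denq_gt0 q; rewrite -(ltr0z rat) => b0.
rewrite -{1}(divq_num_den q) mulrAC ltr_pdivrMr // qa qb -!intrM ltr_int.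
by rewrite -!PoszM ltz_nat [(x * b)%N]mulnC.
Qed.

Lemma gtr_rat_mull (q : rat) (a b x y : nat) :
  numq q = a -> denq q = b -> (b * x < a * y)%N -> x%:Q < q * y%:Q.
Proof.
move=> qa qb lt_xy; have := denq_gt0 q; rewrite -(ltr0z rat) => b0.
rewrite -{1}(divq_num_den q) mulrAC ltr_pdivlMr // qa qb -!intrM ltr_int.
by rewrite -!PoszM ltz_nat [(x * b)%N]mulnC.
Qed.

Theorem theorem1p5 :
  (forall D n : nat, (2 <= D)%N -> (0 < n)%N ->
     ((n%:Z - 2) %/ D%:Z)%Z <= (f n D)%:Z)
  /\ (forall n : nat, (0 < n)%N -> (f n 2)%:Z = (uphalf n)%:Z - 1)
  /\ (exists n0 : nat, forall n : nat, (n0 < n)%N ->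
        [/\ 0.3411%Q * n%:Q < (f n 3)%:Q,
            (f n 3 <= fstar n 3)%N
          & (fstar n 3)%:Q < 0.4591%Q * n%:Q]).
Proof.
split=> [D n D2 n0|].
  (* The integer n - 2 is negative at n = 1; the natural n - 1 bounds it from above. *)
  apply: le_trans (_ : (n.-1 %/ D)%N%:Z <= _); last by rewrite lez_nat f_ge_linear.
  by rewrite -divz_nat; apply: lez_pdiv2r; lia.
split=> [n n0|].
  have := f2_le n0; have := @f_ge_linear n 2 isT n0; lia.
(* Since 0.4591 - 101/220 = 1/110000, the rounding loss of 101 is absorbed once n >= 101 * 110000,
   which is below 4000 * 4000. *)
have [n1 lt_n1] := fstar3_lt; exists (n1 + 4000 * 4000)%N => n lt_n.
split; last 1 first.
- apply: (@gtr_rat_mull 0.4591%Q 4591 (100 * 100) _ _ erefl erefl).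
  have := lt_n1 n; lia.
- apply: (@ltr_rat_mull 0.3411%Q 3411 (100 * 100) _ _ erefl erefl).
  have := @f3_ge n; lia.
exact: f_le_fstar.
Qed.
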